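(* Let $C$ be a (nonempty) completely pseudo-regular code in a finite simple connected graph $\Gamma$, and let $C_k$, $k=0,1,\ldots,\varepsilon_C(=d_C)$, be the subconstituents associated to $C$. Then for every such $k$, $\mathrm{ev}_{C_k}\Gamma\subset\mathrm{ev}_{C}\Gamma$ (non-strict inclusion). Moreover, for each $l=0,1,\ldots,d_C$, the orthogonal projections of $\boldsymbol{\rho}C_k$ and $\boldsymbol{\rho}C$ onto the eigenspace $\ker(\boldsymbol{A}-\mu_l\boldsymbol{I})$ are linearly dependent.
   Context: $\Gamma=(V,E)$ is a finite simple connected graph with vertex set $V=\{1,\ldots,n\}$, adjacency matrix $\boldsymbol{A}$ and distance function $\partial$; $\Gamma(i)$ is the set of neighbours of vertex $i$. The distinct eigenvalues of $\boldsymbol{A}$ are $\lambda_0>\lambda_1>\cdots>\lambda_d$, with eigenspaces $\mathcal{E}_l=\ker(\boldsymbol{A}-\lambda_l\boldsymbol{I})$, and $\boldsymbol{E}_l$ is the orthogonal projection of $\mathbb{R}^n$ onto $\mathcal{E}_l$. The vector $\boldsymbol{\nu}=(\nu_1,\ldots,\nu_n)\in\mathcal{E}_0$ is the unique positive eigenvector with minimum component equal to $1$. The vectors $\boldsymbol{e}_i$ are the coordinate vectors of $\mathbb{R}^n$. For nonempty $S\subset V$, $\boldsymbol{\rho}S:=\sum_{i\in S}\nu_i\boldsymbol{e}_i$ and $\boldsymbol{e}_S:=\boldsymbol{\rho}S/\|\boldsymbol{\rho}S\|$. The $S$-multiplicity of $\lambda_l$ is $m_S(\lambda_l):=\|\boldsymbol{E}_l\boldsymbol{e}_S\|^2$,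 and $\mathrm{ev}_S\Gamma$ is the set of eigenvalues of $\boldsymbol{A}$ with nonzero $S$-multiplicity. The dual degree of $S$ is $d_S:=|\mathrm{ev}_S\Gamma|-1$. Write $\mathrm{ev}_C\Gamma=\{\mu_0>\mu_1>\cdots>\mu_{d_C}\}$. For a vertex $i$, $\partial(i,C)=\min_{j\in C}\partial(i,j)$; the eccentricity of $C$ is $\varepsilon_C=\max_{i\in V}\partial(i,C)$; the subconstituents associated to $C$ are the sets $C_k=\{i\in V:\partial(i,C)=k\}$, $0\le k\le\varepsilon_C$. For $i\in C_k$ put $c(i)=\frac1{\nu_i}\sum_{j\in\Gamma(i)\cap C_{k-1}}\nu_j$ (and $c(i)=0$ if $k=0$), $a(i)=\frac1{\nu_i}\sum_{j\in\Gamma(i)\cap C_k}\nu_j$, $b(i)=\frac1{\nu_i}\sum_{j\in\Gamma(i)\cap C_{k+1}}\nu_j$ (and $b(i)=0$ if $k=\varepsilon_C$). The set $C$ is a completely pseudo-regular code if, for every $k$, the values $c(i),a(i),b(i)$ are the same for all $i\in C_k$. It is a known fact that a completely pseudo-regular code satisfies $\varepsilon_C=d_C$. *)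

(* Defs.v *)
From HB Require Import structures.
From mathcomp Require Import all_boot all_order all_algebra.
From mathcomp Require Import reals polyrcf.

Set Implicit Arguments.
Unset Strict Implicit.
Unset Printing Implicit Defensive.

Import Order.TTheory GRing.Theory Num.Theory.
Local Open Scope ring_scope.

(* A simple graph on 'I_n is a symmetric irreflexive e : rel 'I_n.  Vectors of
   R^n are row vectors acted on from the right; this is harmless because the
   adjacency matrix is symmetric. *)

Section Distance.
Variables (n : nat) (e : rel 'I_n).
Implicit Types (i j : 'I_n) (C : {set 'I_n}) (k : nat).

Definition walk k i j : bool :=
  [exists p : k.-tuple 'I_n, path e i p && (last i p == j)].

(* Length of a shortest walk from i to j: in a connected graph it is less than
   n.  The value n means that j cannot be reached from i. *)
Definition dist i j : nat := find (fun k => walk k i j) (iota 0 n).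

(* The default value n is never reached if C is nonempty and e is connected. *)
Definition dist_set i C : nat := \big[minn/n]_(j in C) dist i j.

Definition ecc C : nat := \max_(i < n) dist_set i C.

Definition subconst C k : {set 'I_n} := [set i | dist_set i C == k].

End Distance.

Section EuclideanSpace.
Variables (R : realType) (n : nat).

Definition norm2 (v : 'rV[R]_n) : R := Num.sqrt (\sum_i v 0 i ^+ 2).

Definition ocompl m (U : 'M[R]_(m, n)) : 'M[R]_n := kermx U^T.

(* v *m oproj U is the orthogonal projection of v onto the row space of U; same
   definition as proj_ortho, which is only available over a numClosedFieldType. *)
Definition oproj m (U : 'M[R]_(m, n)) : 'M[R]_n := proj_mx <<U>>%MS (ocompl U).

(* The distinct eigenvalues of A in R, in decreasing order. *)
Definition spectrum (A : 'M[R]_n) : seq R := rev (rootsR (char_poly A)).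

Lemma mem_spectrum (A : 'M[R]_n) x : (x \in spectrum A) = eigenvalue A x.
Proof.
have := roots_on_rootsR (monic_neq0 (char_poly_monic A)) x.
by rewrite mem_rev eigenvalue_root_char => <-.
Qed.

Lemma spectrum_sorted (A : 'M[R]_n) : sorted (>%R) (spectrum A).
Proof. by rewrite rev_sorted; exact: sorted_roots. Qed.

Lemma oproj_sub m (U : 'M[R]_(m, n)) (v : 'rV[R]_n) : (v *m oproj U <= U)%MS.
Proof. by rewrite (submx_trans (proj_mx_sub _ _ _)) ?genmxE. Qed.

Lemma capmx_ocompl m (U : 'M[R]_(m, n)) : (<<U>> :&: ocompl U)%MS = 0.
Proof.
apply/eqP/rowV0P => v; rewrite sub_capmx genmxE => /andP[/submxP[w ->]].
move=> /sub_kermxP wUU0; have : (w *m U *m (w *m U)^T) 0 0 = 0.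
  by rewrite trmx_mul mulmxA wUU0 mul0mx mxE.
move: (w *m U) => u {w wUU0}.
rewrite mxE => /eqP; rewrite psumr_eq0 => [/allP u0|i _]; last first.
  by rewrite [u^T _ _]mxE -expr2 sqr_ge0.
apply/rowP => i; have := u0 i (mem_index_enum i).
by rewrite [u^T _ _]mxE mxE mulf_eq0 orbb => /eqP.
Qed.

Lemma oproj_compl m (U : 'M[R]_(m, n)) (v : 'rV[R]_n) :
  (v - v *m oproj U) *m U^T = 0.
Proof.
apply/sub_kermxP; apply: proj_mx_compl_sub.
apply: submx_full; rewrite /row_full.
have dxU : mxdirect (<<U>> + ocompl U) by apply/mxdirect_addsP/capmx_ocompl.
by rewrite (mxdirectP dxU) /= genmxE mxrank_ker mxrank_tr subnKC ?rank_leq_col.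
Qed.

End EuclideanSpace.

Section Graph.
Variables (R : realType) (n : nat) (e : rel 'I_n).
Implicit Types (i j : 'I_n) (S C : {set 'I_n}) (nu : 'rV[R]_n) (x : R).

Definition adjmx : 'M[R]_n := \matrix_(i, j) (e i j)%:R.

(* The largest eigenvalue. *)
Definition lambda0 : R := head 0 (spectrum adjmx).

(* By Perron-Frobenius, a connected graph has exactly one such vector. *)
Definition perron_vector nu : Prop :=
  [/\ (nu <= eigenspace adjmx lambda0)%MS,
      forall i, 1 <= nu 0 i & exists i, nu 0 i = 1].

Definition rho nu S : 'rV[R]_n := \sum_(i in S) nu 0 i *: delta_mx 0 i.

Definition evec nu S : 'rV[R]_n := (norm2 (rho nu S))^-1 *: rho nu S.

Definition eigenproj x : 'M[R]_n := oproj (eigenspace adjmx x).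

Definition mult nu S x : R := norm2 (evec nu S *m eigenproj x) ^+ 2.

(* In decreasing order, as inherited from spectrum. *)
Definition ev nu S : seq R := [seq x <- spectrum adjmx | mult nu S x != 0].

Definition dual_degree nu S : nat := (size (ev nu S)).-1.

Definition nbweight nu C i k : R :=
  (nu 0 i)^-1 * \sum_(j in subconst e C k | e i j) nu 0 j.

Definition cnum nu C i : R :=
  if dist_set e i C is k.+1 then nbweight nu C i k else 0.

Definition anum nu C i : R := nbweight nu C i (dist_set e i C).

(* The sum is empty when i is at maximal distance from C. *)
Definition bnum nu C i : R := nbweight nu C i (dist_set e i C).+1.

Definition completely_pseudo_regular nu C : Prop :=
  forall k i j, i \in subconst e C k -> j \in subconst e C k ->
    [/\ cnum nu C i = cnum nu C j, anum nu C i = anum nu C j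
      & bnum nu C i = bnum nu C j].

End Graph.

(* Main.v *)
Require Import Defs.
From HB Require Import structures.
From mathcomp Require Import all_boot all_order all_algebra.
From mathcomp Require Import reals polyrcf.
From mathcomp Require Import zify.

(** Write [rho_k] for the weighted characteristic vector of the subconstituent
    [C_k].  Adjacent vertices lie in the same or in consecutive subconstituents,
    so entry [j] of [rho_k A] vanishes unless [j] lies in [C_(k-1)], [C_k] or
    [C_(k+1)]; there it is [nu_j] times [b(j)], [a(j)] or [c(j)], and complete
    pseudo-regularity makes these factors depend on [k] only:
      [rho_k A = b rho_(k-1) + a rho_k + c rho_(k+1)] ([rho_subconst_adjmx]).
    If [C_(k+1)] is nonempty, the coefficient [c] is nonzero, because a vertex
    at distance [k+1] from [C] has a neighbour at distance [k] and [nu] is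
    positive.  Hence [rho_(k+1)] is a combination of [rho_k A], [rho_k] and
    [rho_(k-1)], trivially so if [C_(k+1)] is empty, and by induction
    [rho_k = rho_0 p_k(A)] for some polynomial [p_k].

    Projecting onto the eigenspace of [x] turns the action of [A] into
    multiplication by [x] ([adjmx_eigenproj]), so the projection of [rho_k] is
    [p_k(x)] times that of [rho_0 = rho C] ([rho_subconst_eigenproj]).  Both
    conclusions are read off this identity.  The induction is run directly on
    the projected vectors, with the scalar [p_k(x)] in place of the polynomial
    [p_k]. *)

Set Implicit Arguments.
Unset Strict Implicit.
Unset Printing Implicit Defensive.

Import Order.TTheory GRing.Theory Num.Theory.
Local Open Scope ring_scope.

(** * Distance to a set in a connected graph *)

Section DistanceToSet.
Variables (n : nat) (e : rel 'I_n).
Implicit Types (i j : 'I_n) (C : {set 'I_n}) (k : nat).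

Lemma walkP k i j :
  reflect (exists p, [/\ path e i p, last i p = j & size p = k]) (walk e k i j).
Proof.
apply: (iffP existsP) => [[p /andP[pp /eqP pj]]|[p [pp pj <-]]].
  by exists p; rewrite size_tuple.
by exists (in_tuple p); rewrite pp pj eqxx.
Qed.

Lemma short_walk i p : path e i p ->
  exists2 m, (m <= size p)%N && (m < n)%N & walk e m i (last i p).
Proof.
case/shortenP => q qP qU qp; exists (size q); last by apply/walkP; exists q.
have := max_card (mem (i :: q)); rewrite (card_uniqP qU) card_ord => ->.
by rewrite andbT; apply: uniq_leq_size => //; case/andP: qU.
Qed.

Hypothesis e_conn : forall i j, connect e i j.

(** The bound [k] is arbitrary, although [dist] only looks for walks with fewer
    than [n] steps: a walk can be shortened until it visits no vertex twice. *)
Lemma dist_leP i j k :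
  reflect (exists p, [/\ path e i p, last i p = j & (size p <= k)%N])
          (dist e i j <= k)%N.
Proof.
apply: (iffP idP) => [dk|[p [/short_walk[m /andP[mp mn] wm] pj pk]]].
  have /connectP[p0 /short_walk[m /andP[_ mn] wm] p0j] := e_conn i j.
  have hw : has (fun k => walk e k i j) (iota 0 n).
    by apply/hasP; exists m; rewrite ?mem_iota // p0j.
  have dn : (dist e i j < n)%N by move: hw; rewrite has_find size_iota.
  have := nth_find 0 hw; rewrite -/(dist e i j) nth_iota // add0n.
  by case/walkP => p [pP pj pd]; exists p; rewrite pd.
apply: leq_trans (leq_trans mp pk); rewrite leqNgt; apply/negP => md.
by have := before_find 0 md; rewrite nth_iota // add0n -pj wm.
Qed.

Variable C : {set 'I_n}.
Hypothesis C_neq0 : C != set0.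

(** Lengths of walks into [C], unlike the nested minima defining [dist_set],
    behave well when an edge is added or removed at the start. *)
Lemma dist_set_leP i k :
  reflect (exists p, [/\ path e i p, last i p \in C & (size p <= k)%N])
          (dist_set e i C <= k)%N.
Proof.
have dle j : j \in C -> (dist_set e i C <= dist e i j)%N.
  by move=> jC; rewrite -leEnat /dist_set -minEnat; exact: bigmin_le_cond.
apply: (iffP idP) => [|[p [pP pC pk]]]; last first.
  by apply: leq_trans (dle _ pC) _; apply/dist_leP; exists p.
have [j0 j0C] := set0Pn _ C_neq0.
have dn j : (dist e i j <= n)%N.
  by rewrite -[X in (_ <= X)%N](size_iota 0) find_size.
(* The default value [n] of the minimum is at least the distance to [j0]. *)
have [j jC ->] : {j | j \in C & dist_set e i C = dist e i j}.
  by rewrite /dist_set -minEnat; apply: eq_bigmin j0C _ => j _; exact: dn.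
by case/dist_leP => p [pP pj pk]; exists p; rewrite pj.
Qed.

Lemma subconst0 : subconst e C 0 = C.
Proof.
apply/setP => i; rewrite inE -leqn0; apply/dist_set_leP/idP => [|iC].
  by case=> -[|j p] [].
by exists [::].
Qed.

Lemma dist_set_edge i j : e i j -> (dist_set e i C <= (dist_set e j C).+1)%N.
Proof.
move=> eij; have /dist_set_leP[p [pP pC pk]] := leqnn (dist_set e j C).
by apply/dist_set_leP; exists (j :: p); rewrite /= eij.
Qed.

Lemma dist_set_step i k :
  dist_set e i C = k.+1 -> exists2 j, e i j & dist_set e j C = k.
Proof.
move=> ik; have := leqnn (dist_set e i C); rewrite {2}ik.
case/dist_set_leP => -[|j p] [] /=.
  move=> _ iC _; suff : (dist_set e i C <= 0)%N by rewrite ik.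
  by apply/dist_set_leP; exists [::].
case/andP => eij pP pC pk; exists j => //; apply/eqP; rewrite eqn_leq.
rewrite -(ltnS k) -ik dist_set_edge // andbT.
by apply/dist_set_leP; exists p.
Qed.

End DistanceToSet.

(** * Projection onto an eigenspace *)

Section OrthogonalProjection.
Variables (R : realType) (n : nat).
Implicit Types (u v : 'rV[R]_n).

Lemma oproj_id m (U : 'M[R]_(m, n)) v : (v <= U)%MS -> v *m oproj U = v.
Proof. by move=> vU; rewrite proj_mx_id ?capmx_ocompl ?genmxE. Qed.

Lemma oproj_0 m (U : 'M[R]_(m, n)) v : v *m U^T = 0 -> v *m oproj U = 0.
Proof. by move=> /sub_kermxP vU; rewrite proj_mx_0 ?capmx_ocompl. Qed.

Lemma norm2_eq0 v : norm2 v = 0 -> v = 0.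
Proof.
move/eqP; rewrite sqrtr_eq0 => v0.
have : \sum_i v 0 i ^+ 2 == 0.
  by rewrite eq_le v0 sumr_ge0 // => i _; exact: sqr_ge0.
rewrite psumr_eq0 => [/allP vi|i _]; last exact: sqr_ge0.
apply/rowP => i; have := vi i (mem_index_enum i).
by rewrite mxE sqrf_eq0 => /eqP.
Qed.

Variable e : rel 'I_n.
Hypothesis e_sym : symmetric e.

Lemma tr_adjmx : (adjmx R e)^T = adjmx R e.
Proof. by apply/matrixP => i j; rewrite !mxE e_sym. Qed.

(** The adjacency matrix is symmetric, so it preserves both the eigenspace of
    [x] and its orthogonal complement; on the former it is multiplication
    by [x]. *)
Lemma adjmx_eigenproj x v :
  v *m adjmx R e *m eigenproj e x = x *: (v *m eigenproj e x).
Proof.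
set U := eigenspace (adjmx R e) x; rewrite /eigenproj -/U.
have UA : U *m adjmx R e = x *: U by apply/eigenspaceP.
have AU : adjmx R e *m U^T = x *: U^T.
  by have := congr1 trmx UA; rewrite trmx_mul tr_adjmx linearZ.
have [u [w [-> uU wU]]] :
    exists u w, [/\ v = u + w, (u <= U)%MS & w *m U^T = 0].
  by exists (v *m oproj U), (v - v *m oproj U); rewrite addrC subrK;
    rewrite oproj_sub oproj_compl.
have uA : u *m adjmx R e = x *: u by exact/eigenspaceP.
have wAU : w *m adjmx R e *m U^T = 0.
  by rewrite -mulmxA AU -scalemxAr wU scaler0.
by rewrite !mulmxDl uA -scalemxAl
  (oproj_id uU) (oproj_0 wU) (oproj_0 wAU) !addr0.
Qed.

End OrthogonalProjection.

(** * The three-term recurrence *)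

Section Recurrence.
Variables (R : realType) (n : nat) (e : rel 'I_n).
Implicit Types (S : {set 'I_n}) (i j : 'I_n).

Lemma rhoE (nu : 'rV[R]_n) S j : rho nu S 0 j = (j \in S)%:R * nu 0 j.
Proof.
rewrite /rho summxE.
under eq_bigr => i _ do rewrite !mxE eqxx /=.
rewrite big_mkcond (bigD1 j) //= eqxx mulr1 big1 ?addr0 => [|i ij].
  by case: ifP; rewrite ?mul1r ?mul0r.
by rewrite [j == i]eq_sym (negPf ij) mulr0 if_same.
Qed.

Lemma constant_on S (f : 'I_n -> R) :
  (forall i j, i \in S -> j \in S -> f i = f j) ->
  exists t, forall j, j \in S -> f j = t.
Proof.
move=> fS; have [->|/set0Pn[i iS]] := eqVneq S set0.
  by exists 0 => j; rewrite inE.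
by exists (f i) => j jS; exact: fS.
Qed.

Hypothesis e_sym : symmetric e.
Hypothesis e_conn : forall i j, connect e i j.
Variable nu : 'rV[R]_n.
Hypothesis nu_gt0 : forall i, 0 < nu 0 i.
Variable C : {set 'I_n}.
Hypothesis C_neq0 : C != set0.

Lemma rho_eq0 S : (rho nu S == 0) = (S == set0).
Proof.
apply/eqP/eqP => [S0|->]; last by rewrite /rho big_set0.
apply/setP => j; rewrite inE; apply/negP => jS.
have := nu_gt0 j; have := congr1 (fun v : 'rV_n => v 0 j) S0.
by rewrite rhoE jS mul1r mxE => ->; rewrite ltxx.
Qed.

Lemma rho_adjmx k j :
  (rho nu (subconst e C k) *m adjmx R e) 0 j = nu 0 j * nbweight e nu C j k.
Proof.
rewrite /nbweight mulrA divff ?gt_eqF // mul1r mxE big_mkcondr /=.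
rewrite [RHS]big_mkcond; apply: eq_bigr => i _.
rewrite rhoE mxE e_sym; case: ifP => _; last by rewrite !mul0r.
by rewrite mul1r; case: ifP; rewrite ?mulr1 ?mulr0.
Qed.

(** The last conjunct makes the recurrence solvable for the next vector. *)
Lemma rho_subconst_adjmx k : completely_pseudo_regular e nu C ->
  exists b a c : R,
    rho nu (subconst e C k) *m adjmx R e =
      b *: rho nu (if k is k'.+1 then subconst e C k' else set0)
      + a *: rho nu (subconst e C k) + c *: rho nu (subconst e C k.+1)
    /\ (subconst e C k.+1 != set0 -> c != 0).
Proof.
move=> cpr; set P := if k is _.+1 then _ else _.
have inP j : (j \in P) = (k == (dist_set e j C).+1).
  by rewrite /P; case: (k) => [|k']; rewrite !inE // eqSS eq_sym.
have inS m j : (j \in subconst e C m) = (dist_set e j C == m) by rewrite inE.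
have [b bP] : exists b, forall j, j \in P -> nbweight e nu C j k = b.
  apply: constant_on => i j; rewrite !inP => /eqP ki /eqP kj.
  have dij : dist_set e i C = dist_set e j C by apply: succn_inj; rewrite -ki.
  have [||_ _] := cpr (dist_set e j C) i j; rewrite ?inS ?dij ?eqxx //.
  by rewrite /bnum dij -kj.
have [a aP] : exists a, forall j, j \in subconst e C k ->
    nbweight e nu C j k = a.
  apply: constant_on => i j ik jk; have [_ + _] := cpr _ _ _ ik jk.
  by move: ik jk; rewrite !inS /anum => /eqP-> /eqP->.
have [c cP] : exists c, forall j, j \in subconst e C k.+1 ->
    nbweight e nu C j k = c.
  apply: constant_on => i j ik jk; have [+ _ _] := cpr _ _ _ ik jk.
  by move: ik jk; rewrite !inS /cnum => /eqP-> /eqP->.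
exists b, a, c; split.
  apply/rowP => j; rewrite rho_adjmx !mxE !rhoE inP !inS.
  move: (bP j) (aP j) (cP j); rewrite inP !inS.
  set d := dist_set e j C => bj aj cj.
  have [kd|kd] := eqVneq k d.+1.
    have [-> ->] : (d == k) = false /\ (d == k.+1) = false by split; lia.
    by rewrite bj ?kd // !mul0r !mulr0 !addr0 mul1r mulrC.
  have [dk|dk] := eqVneq d k.
    have -> : (d == k.+1) = false by lia.
    by rewrite aj ?dk // !mul0r !mulr0 addr0 add0r mul1r mulrC.
  have [dk1|dk1] := eqVneq d k.+1.
    by rewrite cj ?dk1 // !mul0r !mulr0 !add0r mul1r mulrC.
  rewrite !mul0r !mulr0 !addr0 /nbweight big1 ?mulr0 // => i.
  rewrite inS => /andP[/eqP ik eji].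
  (* An edge between [i] in [C_k] and [j] forces [k] and [d] to differ by at
     most one. *)
  have := dist_set_edge e_conn C_neq0 eji.
  rewrite e_sym in eji; have := dist_set_edge e_conn C_neq0 eji.
  by rewrite -/d ik; move: kd dk dk1 => /eqP ? /eqP ? /eqP ?; lia.
case/set0Pn => j jk; rewrite -(cP j jk) /nbweight.
move: jk; rewrite inS => /eqP/(dist_set_step e_conn C_neq0)[i eji ik].
rewrite mulf_neq0 ?invr_neq0 ?gt_eqF //.
rewrite (bigD1 i) /= ?inS ?ik ?eqxx // ltr_pwDl //.
by apply: sumr_ge0 => m _; exact: ltW.
Qed.

Lemma rho_subconst_eigenproj k x : completely_pseudo_regular e nu C ->
  exists t, rho nu (subconst e C k) *m eigenproj e x
            = t *: (rho nu C *m eigenproj e x).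
Proof.
move=> cpr; pose Q S := exists t,
  rho nu S *m eigenproj e x = t *: (rho nu C *m eigenproj e x).
have Q0 : Q set0 by exists 0; rewrite /rho big_set0 mul0mx scale0r.
suff [] : Q (if k is k'.+1 then subconst e C k' else set0)
          /\ Q (subconst e C k) by [].
elim: k => [|k [[t0 t0P] [t1 t1P]]]; first split => //.
  by exists 1; rewrite scale1r subconst0.
split; first by exists t1.
have [->//|Sk] := eqVneq (subconst e C k.+1) set0.
have [b [a [c [rec /(_ Sk) c0]]]] := rho_subconst_adjmx k cpr.
exists (c^-1 * (x * t1 - b * t0 - a * t1)).
have := congr1 (mulmx^~ (eigenproj e x)) rec.
rewrite /= adjmx_eigenproj // !mulmxDl -!scalemxAl t0P t1P.
set v := rho nu C *m _; set w := rho nu _ *m _ => E.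
apply: (scalerI c0); rewrite scalerA mulrA divff // mul1r !scalerBl -!scalerA E.
apply/esym/eqP; rewrite !subr_eq; apply/eqP.
by rewrite addrC [b *: _ + _]addrC addrA.
Qed.

End Recurrence.

Theorem proposition2 (R : realType) (n : nat) (e : rel 'I_n)
    (e_sym : symmetric e) (e_irr : irreflexive e)
    (e_conn : forall i j : 'I_n, connect e i j)
    (nu : 'rV[R]_n) (nuP : perron_vector e nu)
    (C : {set 'I_n}) (C_neq0 : C != set0)
    (C_cpr : completely_pseudo_regular e nu C) :
  (forall k : nat, (k <= ecc e C)%N ->
     {subset ev e nu (subconst e C k) <= ev e nu C}) /\
  (forall k l : nat, (k <= ecc e C)%N -> (l <= dual_degree e nu C)%N ->
     ~~ free [:: rho nu (subconst e C k) *m eigenproj e (ev e nu C)`_l;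
                 rho nu C *m eigenproj e (ev e nu C)`_l]).
Proof.
have nu_gt0 i : 0 < nu 0 i by case: nuP => _ /(_ i) /(lt_le_trans ltr01).
have proj k x := rho_subconst_eigenproj e_sym e_conn nu_gt0 C_neq0 k x C_cpr.
split=> [k _ x|k l _ _].
  rewrite !mem_filter => /andP[+ ->]; rewrite andbT; apply: contra.
  rewrite /mult sqrf_eq0 => /eqP/norm2_eq0/eqP.
  rewrite /evec -!scalemxAl scaler_eq0 invr_eq0.
  have /negPf-> : norm2 (rho nu C) != 0.
    by apply: contra C_neq0 => /eqP/norm2_eq0/eqP; rewrite rho_eq0.
  move=> /= /eqP rE0; have [t ->] := proj k x.
  rewrite rE0 !scaler0 /norm2 big1 ?sqrtr0 ?expr0n // => i _.
  by rewrite mxE expr0n.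
have [t ->] := proj k (ev e nu C)`_l; set v := rho nu C *m _.
rewrite free_cons negb_and negbK; apply/orP; left.
by rewrite memvZ // memv_span ?mem_head.
Qed.
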